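(* Let $G=(V,E)$ be a finite graph, $u:V\to\mathbb{Q}$ a vertex-weight function, $x$ a number, $q$ a positive real number, and let $w:2^E\to\mathbb{Q}_{\ge 0}$ be a cooperative game with $w(\emptyset)=0$. Then the potential $P(w_q(G,u))$ of the $q$-connectivity augmented game $w_q(G,u)$ satisfies $$P(w_q(G,u))=\sum_{R\subseteq E,\ R\text{ flat}} w(R)\,C_q(G.R,u.R,x),$$ where $(G.R,u.R)$ is the vertex-weighted graph obtained from $(G,u)$ by contracting the edges of $R$ and $C_q$ is the weighted $q$-chromatic function.
   Context: Graphs are finite; loops and multiple edges are allowed. ''Number'' may be read as real number. The symbol $\subseteq$ allows equality. Quantum integers: for $p>0$, $(x)_p=\frac{p^x-1}{p-1}$ if $p\neq 1$, and $(x)_1=x$ (so for a positive integer $k$, $(k)_p=1+p+\dots+p^{k-1}$). For $U\subseteq V$ put $u(U)=\sum_{v\in U}u(v)$. Components and flats: for $A\subseteq E$, $c(A)$ is the number of connected components of $(V,A)$. A set $A\subseteq E$ is flat if $c(A)>c(A\cup\{e\})$ for every $e\in E\setminus A$. Games: a cooperative game with finite player set $N$ is a function $v:2^N\to\mathbb{R}$ with $v(\emptyset)=0$; here the players are the edges of $G$. For $R\subseteq N$ put $c_R(v)=\sum_{T\subseteq R}(-1)^{|R|-|T|}v(T)$. $q$-connectivity augmentation: for $R\subseteq E$, the basic $q$-connectivity augmented game is $b_q(R,G,u,x)(S)=|R|\prod_{W}(x)_{q^{u(W)}}$ if $R\subseteq S\subseteq E$ (product over the vertex sets $W$ of the connected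 components of $(V,R)$), and $0$ otherwise. The $q$-connectivity augmented game of $w$ is $w_q(G,u)=\sum_{R\subseteq E}c_R(w)\,b_q(R,G,u,x)$. Shapley value: for a game $v$ on $N$ and a player $e\in N$, $\phi_e(v)=\sum_{e\in R\subseteq N}\frac{1}{|R|}c_R(v)$. Potential: for a game $v$ on $N$ and $S\subseteq N$ let $v|_S$ be the restriction of $v$ to $2^S$. The potential $P$ is determined by $P(v|_\emptyset)=0$ and $P(v|_S)-P(v|_{S\setminus\{e\}})=\phi_e(v|_S)$ for all $S\subseteq N$ and $e\in S$; $P(v)=P(v|_N)$. Weighted $q$-chromatic function: for a graph $H=(V_H,E_H)$ with vertex weights $u_H:V_H\to\mathbb{Q}$, $C_q(H,u_H,x)=\sum_{A\subseteq E_H}(-1)^{|A|}\prod_{W}(x)_{q^{u_H(W)}}$, product over the vertex sets $W$ of the connected components of $(V_H,A)$. Contraction: for $A\subseteq E$, $G.A$ is the graph whose vertices are the connected components of $(V,A)$ and which has exactly one edge for each $e\in E\setminus A$, joining the components containing the ends of $e$ (so loops and multiple edges may occur). The contracted weight $u.A$ assigns to each vertex of $G.A$, i.e. each component $W$ of $(V,A)$, the weight $\sum_{v\in W}u(v)$. *)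

(* Defs.v *)
From mathcomp Require Import all_boot all_order all_algebra.
From mathcomp Require Import boolp reals exp.

Set Implicit Arguments.
Unset Strict Implicit.
Unset Printing Implicit Defensive.

Import Order.TTheory GRing.Theory Num.Theory.

Local Open Scope ring_scope.

Definition qint (R : realType) (p x : R) : R :=
  if p == 1 then x else (p `^ x - 1) / (p - 1).

(* The two ends of an edge are listed in an arbitrary order, which adj ignores;
   they coincide when the edge is a loop. *)
Record mgraph := MGraph {
  vertex : finType;
  edge : finType;
  ends : edge -> vertex * vertex }.

Section Graph.
Variable G : mgraph.
Implicit Types (A : {set edge G}) (v : vertex G).

Definition adj A : rel (vertex G) := fun v1 v2 =>
  [exists e in A, (ends e == (v1, v2)) || (ends e == (v2, v1))].

Definition component A v : {set vertex G} := [set v' | connect (adj A) v v'].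

Definition components A : {set {set vertex G}} :=
  [set component A v | v : vertex G].

Definition flat A : bool :=
  [forall e, (e \notin A) ==> (#|components (e |: A)| < #|components A|)%N].

Definition contract_vertex A : finType := {W | W \in components A}.
Definition contract_edge A : finType := {e : edge G | e \notin A}.

Definition contract_proj A v : contract_vertex A :=
  Sub (component A v) (imset_f (component A) (isT : v \in vertex G)).

Definition contract A : mgraph :=
  @MGraph (contract_vertex A) (contract_edge A)
    (fun e => let: (v1, v2) := ends (val e) in
              (contract_proj A v1, contract_proj A v2)).

Definition weight (u : vertex G -> rat) (W : {set vertex G}) : rat :=
  \sum_(v in W) u v.

Definition contract_weight (u : vertex G -> rat) A : vertex (contract A) -> rat :=
  fun W => weight u (val W).

End Graph.

Section Chromatic.
Variables (R : realType) (q : R) (G : mgraph) (u : vertex G -> rat) (x : R).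
Implicit Types A : {set edge G}.

Definition component_prod A : R :=
  \prod_(W in components A) qint (q `^ ratr (weight u W)) x.

Definition qchromatic : R :=
  \sum_(A : {set edge G}) (-1) ^+ #|A| * component_prod A.

End Chromatic.

(* A game with player set S, a subset of the finite type N, is given by a
   function g on {set N} of which only the values on the subsets of S matter;
   thus the restriction of g to S is represented by the same g with player
   set S. *)
Section Games.
Variables (R : realType) (N : finType).
Implicit Types (g : {set N} -> R) (S T : {set N}) (e : N).

Definition dividend g S : R :=
  \sum_(T : {set N} | T \subset S) (-1) ^+ (#|S| - #|T|) * g T.

Definition shapley g S e : R :=
  \sum_(T : {set N} | (e \in T) && (T \subset S)) #|T|%:R^-1 * dividend g T.

(* P S stands for the potential of the restriction of g to S. *)
Definition is_potential g (P : {set N} -> R) : Prop :=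
  P set0 = 0 /\ forall S e, e \in S -> P S - P (S :\ e) = shapley g S e.

Lemma is_potential_exists g : exists P, is_potential g P.
Proof.
exists (fun S => \sum_(T : {set N} | (T != set0) && (T \subset S))
                    #|T|%:R^-1 * dividend g T); split.
  by rewrite big_pred0 // => T; rewrite subset0 andNb.
move=> S e eS; rewrite (bigID (fun T : {set N} => e \in T)) /=.
rewrite [X in _ + X - _](_ : _ = \sum_(T : {set N} | (T != set0) && (T \subset S :\ e))
    #|T|%:R^-1 * dividend g T); last first.
  by apply: eq_bigl => T; rewrite subsetD1 andbA.
rewrite addrK /shapley; apply: eq_bigl => T; rewrite [LHS]andbC; case: (boolP (e \in T)) => //= eT.
by rewrite andb_idl // => _; apply/set0Pn; exists e.
Qed.

Lemma is_potential_unique g P P' :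
  is_potential g P -> is_potential g P' -> forall S, P S = P' S.
Proof.
move=> [P0 PS] [P'0 P'S] S; have [n] := ubnP #|S|.
elim: n S => // n IHn S ltSn; have [->|[e eS]] := set_0Vmem S.
  by rewrite P0 P'0.
have := PS S e eS; rewrite -(P'S S e eS) (IHn (S :\ e)); first exact: addIr.
by rewrite -ltnS (leq_trans _ ltSn) // ltnS (cardsD1 e S) eS.
Qed.

Definition potential g : R := sval (cid (is_potential_exists g)) [set: N].

End Games.

Section Augmentation.
Variables (R : realType) (q : R) (G : mgraph) (u : vertex G -> rat) (x : R).
Implicit Types A S : {set edge G}.

Definition basic_augmented A S : R :=
  if A \subset S then #|A|%:R * component_prod q u x A else 0.

Definition augmented (g : {set edge G} -> R) S : R :=
  \sum_(A : {set edge G}) dividend g A * basic_augmented A S.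

Lemma augmented_set0 (g : {set edge G} -> R) : augmented g set0 = 0.
Proof.
rewrite /augmented big1 // => A _; rewrite /basic_augmented subset0.
by case: eqP => [->|_]; rewrite ?cards0 ?mul0r mulr0.
Qed.

End Augmentation.

(* Main.v *)
Require Import Defs.
From mathcomp Require Import all_boot all_order all_algebra.
From mathcomp Require Import boolp reals exp.

(* Möbius inversion gives c_T(w_q) = |T| c_T(w) prod_W (x)_{q^u(W)}, so the
   potential is the sum over T of c_T(w) prod_W (x)_{q^u(W)}.  Expanding c_T(w)
   and exchanging sums, the coefficient of w(A) is a signed sum over T containing
   A, which is C_q(G.A, u.A, x) because the components of T correspond to those
   of T \ A in G.A.  If A is not flat, some edge outside A has both ends in one
   component of A, and toggling it in T makes this sum cancel. *)

Set Implicit Arguments.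
Unset Strict Implicit.
Unset Printing Implicit Defensive.

Import Order.TTheory GRing.Theory Num.Theory.

Local Open Scope ring_scope.

(** * Sign-reversing involutions and Möbius inversion over subsets *)

Section AlternatingSums.
Variables (R : pzRingType) (N : finType).
Implicit Types (A S T : {set N}) (e : N) (f : {set N} -> R).

(** Each [T] avoiding [e] is paired with [e |: T] and the two terms cancel. This serves both for
    Möbius inversion and for the vanishing at non-flat sets. *)
Lemma sum_toggle e f :
  (forall T, e \notin T -> f (e |: T) = - f T) -> \sum_T f T = 0.
Proof.
move=> fN; rewrite (bigID (fun T : {set N} => e \in T)) /=.
rewrite (reindex_onto (fun T => e |: T) (fun T => T :\ e)) /=; last first.
  by move=> T /setD1K.
rewrite (eq_bigl (fun T : {set N} => e \notin T)) => [|T]; last first.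
  rewrite setU11 /=; apply/eqP/idP => [<-|/setU1K //].
  by rewrite !inE eqxx.
by rewrite -big_split big1 // => T eT; rewrite /= fN // addNr.
Qed.

Lemma signr_subn m n : (m <= n)%N -> (-1) ^+ (n - m) = (-1) ^+ m * (-1) ^+ n :> R.
Proof. by move=> le_mn; rewrite -signr_odd oddB // signr_addb !signr_odd -!exprD addnC. Qed.

(** If [A] is a proper subset of [S], toggling an element of [S] outside [A] cancels everything; if
    [A] is not contained in [S], no [T] qualifies. *)
Lemma sum_interval_sign A S :
  \sum_(T : {set N} | (T \subset S) && (A \subset T)) (-1) ^+ (#|S| - #|T|)
    = (A == S)%:R :> R.
Proof.
have [->|neqAS] := eqVneq A S.
  rewrite (big_pred1 S) ?subnn // => T.
  by rewrite /= -eqEsubset.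
have [sAS|nsAS] := boolP (A \subset S); last first.
  by rewrite big_pred0 // => T; apply: contraNF nsAS => /andP[TS /subset_trans->].
have /properP[_ [e eS eA]] : A \proper S by rewrite properEneq neqAS.
rewrite big_mkcond; apply: (sum_toggle (e := e)) => T eT.
(* As [e] lies in [S] but not in [A], toggling it does not change whether [T] lies between [A] and
   [S]. *)
rewrite subUset sub1set eS /= -subDset (setDidPl _); last by rewrite disjoint_sym disjoints1.
have [/andP[TS _]|_] := ifP; last by rewrite oppr0.
have le_eT : (#|e |: T| <= #|S|)%N by rewrite subset_leq_card // subUset sub1set eS.
rewrite !signr_subn ?(subset_leq_card TS) // cardsU1 eT.
by rewrite exprS mulN1r mulNr.
Qed.

End AlternatingSums.

Lemma dividend_sum_subset (R : realType) (N : finType) (f : {set N} -> R)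
    (T : {set N}) :
  dividend (fun S => \sum_(A : {set N} | A \subset S) f A) T = f T.
Proof.
rewrite /dividend; under eq_bigr do rewrite mulr_sumr.
rewrite (exchange_big_dep xpredT) //=.
under eq_bigr do rewrite -mulr_suml sum_interval_sign.
rewrite (bigD1 T) //= eqxx mul1r big1 ?addr0 // => A /negPf->.
by rewrite mul0r.
Qed.

(** * Components and redundant edges *)

Section GraphComponents.
Variable G : mgraph.
Implicit Types (A B S T : {set edge G}) (e : edge G) (v : vertex G).

Lemma adj_sym A : symmetric (adj A).
Proof. by move=> v1 v2; apply: eq_existsb => e; rewrite orbC. Qed.

Lemma connect_adj_sym A : connect_sym (adj A).
Proof. exact/sym_connect_sym/adj_sym. Qed.

Lemma component_eq A v1 v2 :
  (component A v1 == component A v2) = connect (adj A) v1 v2.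
Proof.
apply/eqP/idP => [eqA|c12].
  by have := connect0 (adj A) v2; rewrite -[connect _ _ _]in_set -[finset _]/(component A v2) -eqA inE.
by apply/setP => v; rewrite !inE (same_connect (@connect_adj_sym A) c12).
Qed.

Lemma adj_ends A e v1 v2 : e \in A -> ends e = (v1, v2) -> adj A v1 v2.
Proof. by move=> eA ee; apply/existsP; exists e; rewrite eA ee eqxx. Qed.

Lemma connect_adjS A B : A \subset B ->
  subrel (connect (adj A)) (connect (adj B)).
Proof.
move=> /subsetP sAB; apply: connect_sub => v1 v2 /existsP[e /andP[eA ee]].
by apply/connect1/existsP; exists e; rewrite sAB.
Qed.

(* The card inequality makes the surjection from the components of A onto those
   of e |: A injective. *)
Lemma nonflat_ends A : ~~ flat A ->
  exists2 e, e \notin A & connect (adj A) (ends e).1 (ends e).2.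
Proof.
move=> /forallPn[e]; rewrite negb_imply -leqNgt => /andP[eA le_card]; exists e => //.
pose f (W : {set vertex G}) := \bigcup_(v in W) component (e |: A) v.
have fE v : f (component A v) = component (e |: A) v.
  apply/setP => v'; apply/bigcupP/idP => [[v'']|v'v]; last by exists v => //; rewrite inE.
  rewrite !inE => /(connect_adjS (subsetUr [set e] A)) c1; exact: connect_trans.
have im_f : f @: components A = components (e |: A).
  by rewrite -imset_comp; apply: eq_imset => v /=.
have /imset_injP f_inj : #|f @: components A| == #|components A|.
  by rewrite eqn_leq leq_imset_card im_f.
rewrite -component_eq; apply/eqP/f_inj; rewrite ?imset_f // !fE; apply/eqP.
rewrite component_eq; apply: connect1.
by apply: (@adj_ends _ e); rewrite ?setU11 // -surjective_pairing.
Qed.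

(** Any use of [e] in a path can be replaced by a path in [T] between its ends. *)
Lemma components_setU1 T e : connect (adj T) (ends e).1 (ends e).2 ->
  components (e |: T) = components T.
Proof.
move=> ce; apply: eq_imset => v; apply/setP => v'; rewrite !inE.
apply/idP/idP; last exact/connect_adjS/subsetUr.
apply: connect_sub => v1 v2 /existsP[e' /andP[]].
rewrite in_setU1 => /orP[/eqP-> | e'T ee]; last first.
  by apply/connect1/existsP; exists e'; rewrite e'T.
by case/orP => /eqP ee; rewrite ee /= in ce; rewrite // connect_adj_sym.
Qed.

End GraphComponents.

(** * Connectivity and the chromatic function after contraction *)

Section Contraction.
Variables (G : mgraph) (A : {set edge G}).
Implicit Types (B : {set edge (contract A)}) (v : vertex G).

Lemma contract_proj_eq v1 v2 :
  (contract_proj A v1 == contract_proj A v2) = connect (adj A) v1 v2.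
Proof. by rewrite -val_eqE /= component_eq. Qed.

Lemma contract_proj_surj (W : vertex (contract A)) :
  exists v, W = contract_proj A v.
Proof.
have /imsetP[v _ Wv] := valP W; exists v.
exact: val_inj.
Qed.

Lemma mem_contract_vertex (W : vertex (contract A)) v :
  (v \in val W) = (contract_proj A v == W).
Proof.
by have [v' ->] := contract_proj_surj W; rewrite contract_proj_eq inE connect_adj_sym.
Qed.

Lemma ends_contract (e : edge (contract A)) : ends e =
  (contract_proj A (ends (val e)).1, contract_proj A (ends (val e)).2).
Proof. by rewrite /=; case: (ends _). Qed.

(** A path of contracted edges lifts once consecutive edges are joined by paths inside components of
    [A]. Conversely, projection collapses the edges of [A] and sends the others to edges of [B]. *)
Lemma connect_contract B v1 v2 :
  connect (adj B) (contract_proj A v1 : vertex (contract A)) (contract_proj A v2) =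
  connect (adj (A :|: val @: B)) v1 v2.
Proof.
set T := A :|: _; have sAT : A \subset T := subsetUl _ _.
have lift v v' : contract_proj A v = contract_proj A v' -> connect (adj T) v v'.
  by move/eqP; rewrite contract_proj_eq; apply: connect_adjS.
apply/idP/idP.
  move=> /connectP[p]; elim: p v1 => [|W p IHp] v1 /=; first by move=> _ /lift; rewrite connect_adj_sym.
  have [v ->] := contract_proj_surj W.
  case/andP=> /existsP[e /andP[eB ee]] pp pl.
  apply: connect_trans (IHp v pp pl).
  have eT : val e \in T by rewrite inE imset_f ?orbT.
  have ce : connect (adj T) (ends (val e)).1 (ends (val e)).2.
    by apply/connect1/(adj_ends eT); rewrite -surjective_pairing.
  move: ee; rewrite ends_contract !xpair_eqE.
  case/orP => /andP[/eqP/lift ev1 /eqP/lift ev2].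
    by rewrite connect_adj_sym in ev1; apply: connect_trans ev1 (connect_trans ce ev2).
  rewrite connect_adj_sym in ev1; rewrite connect_adj_sym.
  exact: connect_trans ev1 (connect_trans ce ev2).
move=> /connectP[p]; elim: p v1 => [|v p IHp] v1 /=; first by move=> _ ->.
case/andP=> /existsP[e /andP[eT ee]] pp pl.
apply: connect_trans (IHp v pp pl).
have [eA|eA] := boolP (e \in A).
  have /eqP-> : contract_proj A v1 == contract_proj A v; last exact: connect0.
  by rewrite contract_proj_eq; apply/connect1/existsP; exists e; rewrite eA.
move: eT ee; rewrite inE (negPf eA) => /imsetP[e' e'B ->] ee.
apply/connect1/existsP; exists e'; rewrite e'B ends_contract.
by case/orP: ee => /eqP-> /=; rewrite eqxx ?orbT.
Qed.

Lemma components_contract B :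
  components (A :|: val @: B) =
  [set [set v | contract_proj A v \in W] | W : {set vertex (contract A)} in components B].
Proof.
have fE v : [set v' | contract_proj A v' \in component B (contract_proj A v : vertex (contract A))]
    = component (A :|: val @: B) v.
  by apply/setP => v'; rewrite !inE connect_contract.
apply/setP => W; apply/imsetP/imsetP => [[v _ ->]|[W' /imsetP[V _ ->] ->]].
  by exists (component B (contract_proj A v : vertex (contract A))); rewrite ?imset_f.
by have [v ->] := contract_proj_surj V; exists v.
Qed.

(** The vertices of the preimage are grouped by the component of [A] containing them. *)
Lemma weight_contract (u : vertex G -> rat) (W : {set vertex (contract A)}) :
  weight (contract_weight u (A := A)) W = weight u [set v | contract_proj A v \in W].
Proof.
rewrite [RHS](partition_big (contract_proj A : _ -> vertex (contract A)) (mem W)) /=; last first.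
  by move=> v; rewrite inE.
apply: eq_bigr => V VW; apply: eq_bigl => v.
by rewrite mem_contract_vertex inE andbC; case: eqP => //= ->; rewrite VW.
Qed.

Variables (R : realType) (q : R) (u : vertex G -> rat) (x : R).

Lemma component_prod_contract B :
  component_prod q (contract_weight u (A := A)) x B =
  component_prod q u x (A :|: val @: B).
Proof.
rewrite /component_prod components_contract [RHS]big_imset.
  by apply: eq_bigr => W _; rewrite weight_contract.
(* Taking preimages is injective because [contract_proj A] is surjective, so no factor of the
   product is merged with another. *)
move=> W1 W2 _ _ /setP eqW; apply/setP => V.
by have [v ->] := contract_proj_surj V; have := eqW v; rewrite !inE.
Qed.

(** Edge sets [B] of the contraction correspond bijectively to supersets [T] of [A], with inverse
    [T] minus [A]; disjointness from [A] gives the exponent. *)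
Lemma qchromatic_contract :
  qchromatic q (contract_weight u (A := A)) x =
  \sum_(T : {set edge G} | A \subset T) (-1) ^+ (#|T| - #|A|) * component_prod q u x T.
Proof.
rewrite [RHS](reindex_onto (fun B : {set edge (contract A)} => A :|: val @: B)
                   (fun T => [set e | val e \in T])) /=; last first.
  move=> T sAT; apply/setP => e; rewrite inE.
  have [eA|eA] := boolP (e \in A); first by rewrite (subsetP sAT).
  apply/imsetP/idP => [[e' + ->]|eT]; first by rewrite inE.
  by exists (Sub e eA : edge (contract A)); rewrite ?inE SubK.
apply: eq_big => [B|B _].
  rewrite subsetUl; apply/esym/eqP/setP => e.
  by rewrite !inE (negPf (valP e)) mem_imset //; apply: val_inj.
rewrite component_prod_contract; congr (_ ^+ _ * _).
rewrite cardsU (_ : A :&: _ = set0) ?cards0 ?subn0.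
  by rewrite addKn card_imset //; apply: val_inj.
apply/setP => e; rewrite !inE; apply/negP => /andP[eA /imsetP[e' _ ee']].
by have := valP e'; rewrite /= -[sval e']ee' eA.
Qed.

(** The edge [e] has connected ends already in [A], hence in every superset [T]; adding it keeps the
    components and flips the sign. *)
Lemma qchromatic_contract_nonflat :
  ~~ flat A -> qchromatic q (contract_weight u (A := A)) x = 0.
Proof.
move=> /nonflat_ends[e eA ce]; rewrite qchromatic_contract big_mkcond.
apply: (sum_toggle (e := e)) => T eT.
rewrite -subDset (setDidPl _); last by rewrite disjoint_sym disjoints1.
have [sAT|_] := ifP; last by rewrite oppr0.
rewrite /component_prod components_setU1; last exact: connect_adjS ce.
by rewrite cardsU1 eT subSn ?subset_leq_card // exprS mulN1r mulNr.
Qed.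

End Contraction.

(** * The potential of the augmented game *)

Lemma potential_eq (R : realType) (N : finType) (g P : {set N} -> R) :
  is_potential g P -> potential g = P [set: N].
(* [potential] comes from a choice of witness, so only uniqueness gives access to its value. *)
Proof. by move=> gP; apply: is_potential_unique (svalP (cid _)) gP _. Qed.

Section AugmentedPotential.
Variables (R : realType) (G : mgraph) (q : R) (u : vertex G -> rat) (x : R).
Variable g : {set edge G} -> R.

(** The augmented game at [S] sums [f] over the subsets of [S], so Möbius inversion reads off its
    dividends. *)
Lemma dividend_augmented T :
  dividend (augmented q u x g) T =
  dividend g T * (#|T|%:R * component_prod q u x T).
Proof.
pose f A := dividend g A * (#|A|%:R * component_prod q u x A).
rewrite -[RHS]/(f T) -(dividend_sum_subset f); apply: eq_bigr => S _; congr (_ * _).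
rewrite [RHS]big_mkcond; apply: eq_bigr => A _.
by rewrite /basic_augmented; case: ifP; rewrite ?mulr0.
Qed.

(** An explicit candidate [P] is checked on every [S]; the factor [#|T|] of the augmented dividend
    cancels the weight in the Shapley value. *)
Lemma potential_augmented : g set0 = 0 ->
  potential (augmented q u x g) =
  \sum_(T : {set edge G}) dividend g T * component_prod q u x T.
Proof.
move=> g0; pose P (S : {set edge G}) :=
  \sum_(T : {set edge G} | T \subset S) dividend g T * component_prod q u x T.
rewrite (@potential_eq _ _ _ P); first by apply: eq_bigl => T; rewrite subsetT.
split=> [|S e eS].
  rewrite /P (big_pred1 set0) => [|T]; last by rewrite subset0.
  (* The dividend of the empty set is [g set0], which makes [P set0] vanish. *)
  rewrite /dividend (big_pred1 set0) => [|T]; last by rewrite subset0.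
  by rewrite g0 mulr0 mul0r.
rewrite /P (bigID (fun T : {set edge G} => e \in T)) /=.
under [X in _ + X - _]eq_bigl do rewrite -subsetD1.
rewrite addrK; apply: eq_big => [T|T /andP[_ eT]]; first by rewrite andbC.
(* The cancellation needs [#|T|] nonzero, which holds since [e] lies in [T]. *)
rewrite dividend_augmented [RHS]mulrCA mulKf // pnatr_eq0 -lt0n card_gt0.
by apply/set0Pn; exists e.
Qed.

Lemma sum_dividend_component_prod :
  \sum_(T : {set edge G}) dividend g T * component_prod q u x T =
  \sum_(A : {set edge G}) g A * qchromatic q (contract_weight u (A := A)) x.
Proof.
under eq_bigr do rewrite mulr_suml.
rewrite (exchange_big_dep xpredT) //=; apply: eq_bigr => A _.
rewrite qchromatic_contract mulr_sumr; apply: eq_bigr => T _.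
by rewrite mulrAC mulrC.
Qed.

End AugmentedPotential.

Theorem theorem15 (R : realType) (G : mgraph) (u : vertex G -> rat) (x q : R)
    (w : {set edge G} -> rat)
    (q_gt0 : 0 < q)
    (w_ge0 : forall A : {set edge G}, 0 <= w A)
    (w0 : w set0 = 0) :
  potential (augmented q u x (fun A : {set edge G} => ratr (w A) : R)) =
  \sum_(A : {set edge G} | flat A)
    ratr (w A) * qchromatic q (contract_weight u (A := A)) x.
Proof.
rewrite potential_augmented ?w0 ?rmorph0 // sum_dividend_component_prod.
rewrite (bigID (@flat G)) /= [X in _ + X]big1 ?addr0 // => A nfA.
by rewrite qchromatic_contract_nonflat ?mulr0.
Qed.
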